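(* Let $\Psi=\exists^{\geq\beta(v_1)}v_1\cdots\exists^{\geq\beta(v_n)}v_n\bigwedge_{v_iv_k\in E(G)}E(v_i,v_k)$ be an instance of $\{1,2\}$-CSP$(\mathbf{P}_\infty)$ with graph $G$, order $\prec$ and $\beta:V(G)\to\{1,2\}$, and suppose $G$ is bipartite. Then the following are equivalent: (I) $\mathbf{P}_\infty \models \Psi$; (II) Prover has a winning strategy in the game $\mathscr{G}(\Psi,\mathbf{P}_\infty)$; (III) Prover can play $\mathscr{G}(\Psi,\mathbf{P}_\infty)$ so that in every play the resulting mapping $f:V(G)\to\mathbb{Z}$ satisfies, for all $u,v\in V(G)$ with $\delta(u,v)<\infty$, both $|f(u)-f(v)|\leq \delta(u,v)$ and that $f(u)+f(v)+\delta(u,v)$ is even; (IV) there are no $u,v\in V(G)$ with $u\prec v$ and $\delta(u,v)\leq \beta(v)-2$; (V) there is no bad walk in $G$.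
   Context: $\mathbf{P}_\infty$ is the graph with vertex set $\mathbb{Z}$ and edges $\{i,k\}$ with $|i-k|=1$. An instance of $\{1,2\}$-CSP$(\mathbf{P}_\infty)$ is a sentence in which each variable $v$ is quantified by $\exists^{\geq \beta(v)}$, $\beta(v)\in\{1,2\}$ ($\exists^{\geq j}$: at least $j$ distinct elements), followed by a conjunction of atoms $E(v_i,v_k)$; $G$ is the graph on the variables with an edge $v_iv_k$ for each atom, and $\prec$ is the quantification order. For sets, $X\prec Y$ means $x\prec y$ for all $x\in X,y\in Y$. Game $\mathscr{G}(\Psi,\mathbf{P}_\infty)$: going through the variables in order $\prec$, for variable $v$ Prover offers a set of $\beta(v)$ distinct integers and Adversary picks one of them as $f(v)$; Prover wins if $f$ is a homomorphism $G\to\mathbf{P}_\infty$. A walk $x_1,\ldots,x_r$ has length $|Q|=r-1$ and $\lambda(Q)=|Q|-2\sum_{i=2}^{r-1}(\beta(x_i)-1)$. Looping walks are defined recursively: a walk $x_1,\ldots,x_r$ is looping if $x_1\neq x_r$ and, when $r\geq 3$, (i) $\{x_1,x_r\}\prec\{x_2,\ldots,x_{r-1}\}$ and (ii) there is $\ell\notin\{1,r\}$ such that both $x_1,\ldots,x_\ell$ and $x_\ell,\ldots,x_r$ are looping walks (for $r=2$, a looping walk is just two distinct adjacent vertices). $\delta(u,v)$ is the minimum of $\lambda(Q)$ over looping walks $Q$ with endpoints $u$ and $v$ (in either order), and $\delta(u,v)=\infty$ if none exists. A bad walk is a looping walk $Q=x_1,\ldots,x_r$ with $x_1\prec x_r$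 and $\lambda(Q)\leq \beta(x_r)-2$. *)

(* Defs.v *)
From mathcomp Require Import all_boot all_order all_algebra.
From mathcomp Require Import finmap boolp constructive_ereal zify.

Set Implicit Arguments.
Unset Strict Implicit.
Unset Printing Implicit Defensive.

Import Order.TTheory GRing.Theory Num.Theory.

Local Open Scope nat_scope.

Definition P_infty : rel int := fun i k => `|i - k|%R == 1%R.

(* First-order formulas over one binary relation symbol, with the counting
   quantifiers "there exist at least j elements"; the variables are 'I_n. *)
Inductive formula (n : nat) : Type :=
  | FTrue
  | FAtom of 'I_n & 'I_n
  | FAnd of formula n & formula n
  | FExists_ge of nat & 'I_n & formula n.

Arguments FTrue {n}.

Definition upd (n : nat) (T : Type) (a : 'I_n -> T) (v : 'I_n) (t : T) :
    'I_n -> T :=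
  fun u => if u == v then t else a u.

Fixpoint sat (n : nat) (T : choiceType) (E : rel T) (a : 'I_n -> T)
    (phi : formula n) : Prop :=
  match phi with
  | FTrue => True
  | FAtom u v => E (a u) (a v)
  | FAnd phi1 phi2 => sat E a phi1 /\ sat E a phi2
  | FExists_ge j v psi =>
      exists2 S : {fset T}, j <= #|` S| &
        forall t, t \in S -> sat E (upd a v t) psi
  end.

Definition models (n : nat) (T : choiceType) (E : rel T) (phi : formula n) :
  Prop := forall a : 'I_n -> T, sat E a phi.

(* The variables v_1, ..., v_n are the elements of 'I_n, so that the
   quantification order is the order of 'I_n. *)
Record instance (n : nat) : Type := Instance {
  beta : 'I_n -> nat;
  beta12 : forall v, beta v = 1 \/ beta v = 2;
  atoms : seq ('I_n * 'I_n)
}.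

Definition sentence (n : nat) (Psi : instance n) : formula n :=
  foldr (fun v phi => FExists_ge (beta Psi v) v phi)
    (foldr (@FAnd n) FTrue [seq FAtom a.1 a.2 | a <- atoms Psi])
    (enum 'I_n).

Definition edge (n : nat) (Psi : instance n) : rel 'I_n :=
  fun u v => ((u, v) \in atoms Psi) || ((v, u) \in atoms Psi).

Definition bipartite (V : Type) (e : rel V) : Prop :=
  exists c : V -> bool, forall u v, e u v -> c u != c v.

(* A strategy of Prover maps the current variable and the values chosen by
   Adversary for the earlier variables (in order) to the set that is offered. *)
Definition strategy (n : nat) (T : choiceType) : Type :=
  'I_n -> seq T -> {fset T}.

Definition legal (n : nat) (T : choiceType) (Psi : instance n)
    (sigma : strategy n T) : Prop :=
  forall v h, #|` sigma v h| = beta Psi v.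

Definition history (n : nat) (T : Type) (f : 'I_n -> T) (v : 'I_n) : seq T :=
  [seq f u | u : 'I_n <- enum 'I_n & u < v].

Definition play (n : nat) (T : choiceType) (sigma : strategy n T)
    (f : 'I_n -> T) : Prop :=
  forall v, f v \in sigma v (history f v).

Definition homomorphism (V T : Type) (e : rel V) (E : rel T) (f : V -> T) :
  Prop := forall u v, e u v -> E (f u) (f v).

(* Prover can play the game so that the mapping resulting from any play
   satisfies W. *)
Definition prover_can_ensure (n : nat) (T : choiceType) (Psi : instance n)
    (W : ('I_n -> T) -> Prop) : Prop :=
  exists2 sigma : strategy n T, legal Psi sigma &
    forall f, play sigma f -> W f.

Definition prover_wins (n : nat) (T : choiceType) (Psi : instance n)
    (E : rel T) : Prop :=
  prover_can_ensure Psi (homomorphism (edge Psi) E).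

(* looping Psi x p y: the sequence x :: rcons p y is a looping walk. Both ends
   of a looping walk are distinct, so every looping walk has this form. *)
Inductive looping (n : nat) (Psi : instance n) :
    'I_n -> seq 'I_n -> 'I_n -> Prop :=
  | looping_edge (x y : 'I_n) : x != y -> edge Psi x y -> looping Psi x [::] y
  | looping_split (x : 'I_n) p (z : 'I_n) q (y : 'I_n) :
      x != y ->
      all (fun w : 'I_n => (x < w) && (y < w)) (p ++ z :: q) ->
      looping Psi x p z -> looping Psi z q y ->
      looping Psi x (p ++ z :: q) y.

(* The value of lambda on a walk x :: rcons p y, which has length (size p).+1
   and depends only on p. *)
Definition lambda (n : nat) (Psi : instance n) (p : seq 'I_n) : int :=
  ((size p).+1%:Z - 2 * \sum_(w <- p) ((beta Psi w)%:Z - 1))%R.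

Lemma looping_path (n : nat) (Psi : instance n) x p y :
  looping Psi x p y -> path (edge Psi) x (rcons p y).
Proof.
elim=> {x p y} [x y _ exy|x p z q y _ _ _ IHp _ IHq] /=; first by rewrite exy.
by rewrite rcons_cat rcons_cons -cat_rcons cat_path IHp last_rcons.
Qed.

Lemma looping_size (n : nat) (Psi : instance n) x p y :
  looping Psi x p y -> (size p).+1 <= 2 ^ (n - maxn x y).
Proof.
elim=> {x p y} [x y _ _|x p z q y _ lt_pq _ IHp _ IHq]; first by rewrite expn_gt0.
have /andP[xz yz] : (x < z) && (y < z).
  by move/allP: lt_pq; apply; rewrite mem_cat mem_head orbT.
rewrite (maxn_idPr (ltnW xz)) in IHp; rewrite (maxn_idPl (ltnW yz)) in IHq.
rewrite size_cat /= addnS -addSn -addnS.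
apply: (@leq_trans (2 ^ (n - z).+1)).
  by rewrite expnS mul2n -addnn leq_add.
by rewrite leq_exp2l //; have := ltn_ord z; lia.
Qed.

Lemma looping_lambda_ge (n : nat) (Psi : instance n) x p y :
  looping Psi x p y -> (- (2 ^ n.+1)%:Z <= lambda Psi p)%R.
Proof.
move=> /looping_size size_p.
have {}size_p : size p < 2 ^ n.
  by apply: leq_trans size_p _; rewrite leq_exp2l // leq_subr.
have : (\sum_(w <- p) ((beta Psi w)%:Z - 1) <= (size p)%:Z)%R.
  elim: p {size_p} => [|w p IHp]; rewrite ?big_nil ?big_cons //=.
  move: IHp; set S := (\sum_(j <- p) _)%R; move: S => S.
  by case: (beta12 Psi w) => ->; lia.
rewrite /lambda expnS; set S := (\sum_(w <- p) _)%R => leS.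
by move: S (2 ^ n) leS size_p => S N; lia.
Qed.

(* d is the minimum of lambda over the looping walks with endpoints u and v. *)
Definition is_delta (n : nat) (Psi : instance n) (u v : 'I_n) (d : \bar int) :
    Prop :=
  match d with
  | EFin m =>
      (exists2 p, looping Psi u p v \/ looping Psi v p u & lambda Psi p = m) /\
      (forall p, looping Psi u p v \/ looping Psi v p u ->
         (m <= lambda Psi p)%R)
  | +oo%E => forall p, ~ (looping Psi u p v \/ looping Psi v p u)
  | -oo%E => False
  end.

Lemma is_delta_exists (n : nat) (Psi : instance n) (u v : 'I_n) :
  exists d, is_delta Psi u v d.
Proof.
pose L p := looping Psi u p v \/ looping Psi v p u.
have [[p0 Lp0]|nL] := pselect (exists p, L p); last first.
  by exists +oo%E => p Lp; apply: nL; exists p.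
have Lge p : L p -> (- (2 ^ n.+1)%:Z <= lambda Psi p)%R.
  by case; apply: looping_lambda_ge.
pose P k := `[< exists2 p, L p & (lambda Psi p + (2 ^ n.+1)%:Z = k%:Z)%R >].
have exP p : L p -> P `|(lambda Psi p + (2 ^ n.+1)%:Z)%R|.
  by move=> Lp; apply/asboolP; exists p => //; have := Lge p Lp; lia.
have exk : exists k, P k by eexists; apply: exP Lp0.
case: (ex_minnP exk) => k /asboolP[p Lp lp] kmin.
exists (lambda Psi p)%:E; split; first by exists p.
by move=> q Lq; have := kmin _ (exP q Lq); have := Lge q Lq; lia.
Qed.

Definition delta (n : nat) (Psi : instance n) (u v : 'I_n) : \bar int :=
  sval (cid (is_delta_exists Psi u v)).

Definition bad_walk (n : nat) (Psi : instance n) (x : 'I_n) (p : seq 'I_n)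
    (y : 'I_n) : Prop :=
  [/\ looping Psi x p y, x < y & (lambda Psi p <= (beta Psi y)%:Z - 2)%R].

(* Main.v *)
(* A looping walk from x to y bounds |f x - f y| by its lambda in every play
   won by Prover: at a vertex z with beta z = 2 Adversary may answer either of
   the two offered values, these have the same parity and hence are at least 2
   apart, so the bounds through z tighten by 2.  Conversely, if there is no bad
   walk, Prover maintains |f x - f y| <= lambda for all looping walks between
   the vertices played so far.  The values allowed for the next vertex v form
   intervals around the earlier values; two of them overlap sufficiently
   because the concatenation at v of two looping walks is again looping, and
   one-dimensional Helly gives a common value (two if beta v = 2). *)
Require Import Defs.
From mathcomp Require Import all_boot all_order all_algebra.
From mathcomp Require Import finmap boolp constructive_ereal zify.
(* Makes [looping] denote looping walks again, and not [path.looping]. *)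
Import Defs.

Set Implicit Arguments.
Unset Strict Implicit.
Unset Printing Implicit Defensive.

Import Order.TTheory GRing.Theory Num.Theory.

(** * Histories as prefixes of the variable order *)

Lemma filter_ltn_enum_ord n k : k <= n ->
  [seq u : 'I_n <- enum 'I_n | u < k] = take k (enum 'I_n).
Proof.
move=> le_kn; apply: (inj_map val_inj).
rewrite map_take -(filter_map val (fun i => i < k)) val_enum_ord.
by rewrite (filter_iota_ltn 0 le_kn) take_iota (minn_idPl le_kn).
Qed.

Lemma historyE n (T : Type) (f : 'I_n -> T) (v : 'I_n) :
  history f v = [seq f u | u <- take v (enum 'I_n)].
Proof. by rewrite /history filter_ltn_enum_ord // ltnW. Qed.

Lemma take_ord_enumS n (v : 'I_n) :
  take v.+1 (enum 'I_n) = rcons (take v (enum 'I_n)) v.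
Proof. by rewrite (take_nth v) ?size_enum_ord // nth_ord_enum. Qed.

Lemma drop_ord_enum n (v : 'I_n) :
  drop v (enum 'I_n) = v :: drop v.+1 (enum 'I_n).
Proof. by rewrite (drop_nth v) ?size_enum_ord // nth_ord_enum. Qed.

Lemma eq_history n (T : Type) (f g : 'I_n -> T) (v : 'I_n) :
  (forall u : 'I_n, (u < v)%N -> f u = g u) -> history f v = history g v.
Proof.
move=> fg; apply/eq_in_map => u; rewrite mem_filter => /andP[uv _].
exact: fg.
Qed.

(** Course-of-values recursion along the order; it turns a rule for Adversary's answers into a whole
    play. *)
Lemma exists_history_rec n (T : Type) (ch : 'I_n -> seq T -> T) :
  exists f : 'I_n -> T, forall v, f v = ch v (history f v).
Proof.
(* [g k] lists the first [k] values; [insub] succeeds because only [k <= n] matters. *)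
pose g := fix g k := if k is k'.+1 then
  if insub k' is Some v then rcons (g k') (ch v (g k')) else g k' else [::].
pose f v := ch v (g (val v)).
suff gE k : (k <= n)%N -> [seq f u | u <- take k (enum 'I_n)] = g k.
  by exists f => v; rewrite historyE gE // ltnW.
elim: k => [|k IHk] lt_kn; first by rewrite take0.
rewrite -[k]/(val (Ordinal lt_kn)) take_ord_enumS map_rcons IHk 1?ltnW //=.
by rewrite insubT.
Qed.

(** * Plays against a fixed legal strategy *)

Section Strategies.
Variables (n : nat) (T : choiceType) (Psi : instance n) (sigma : strategy n T).
Hypothesis sigma_legal : legal Psi sigma.

Lemma legal_pick v h : exists t, t \in sigma v h.
Proof.
apply/fset0Pn; rewrite -cardfs_gt0 sigma_legal.
by case: (beta12 Psi v) => ->.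
Qed.

Lemma play_exists : exists f, play sigma f.
Proof.
have [f fE] := exists_history_rec (fun v h => sval (cid (legal_pick v h))).
by exists f => v; rewrite fE; case: cid.
Qed.

(** Adversary repeats the answers before [z] and gives [b] at [z]; the later offers may have
    changed, so from there on arbitrary offered values are taken. *)
Lemma play_deviate f z b : play sigma f -> b \in sigma z (history f z) ->
  exists g, [/\ play sigma g, forall u : 'I_n, (u < z)%N -> g u = f u &
                g z = b].
Proof.
move=> fP bP.
have [g gE] := exists_history_rec (fun v h =>
  if (v < z)%N then f v else if v == z then b
  else sval (cid (legal_pick v h))).
have glt (u : 'I_n) : (u < z)%N -> g u = f u by move=> uz; rewrite gE uz.
have gz : g z = b by rewrite gE ltnn eqxx.
exists g; split=> // v; have [vz|zv|/val_inj->] := ltngtP v z.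
- rewrite glt // (@eq_history _ _ g f) // => u uv.
  by apply: glt; apply: ltn_trans vz.
- have vz : v == z = false by apply/eqP => vz; move: zv; rewrite vz ltnn.
  by rewrite {1}gE ltnNge (ltnW zv) vz; case: cid.
- by rewrite gz (@eq_history _ _ g f).
Qed.

Lemma play_other_value f z : play sigma f -> beta Psi z = 2 ->
  exists g, [/\ play sigma g, forall u : 'I_n, (u < z)%N -> g u = f u &
                g z != f z].
Proof.
move=> fP bz; have: (0 < #|` (sigma z (history f z) `\ f z)%fset|)%N.
  by have := cardfsD1 (f z) (sigma z (history f z));
     rewrite sigma_legal bz fP; lia.
rewrite cardfs_gt0 => /fset0Pn[b]; rewrite !inE => /andP[bf bS].
by have [g [gP gf gb]] := play_deviate fP bS; exists g; rewrite gb.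
Qed.

End Strategies.

(** * From truth of the sentence to a winning strategy *)

Section Sentences.
Variables (n : nat) (T : choiceType) (E : rel T) (Psi : instance n).

(** The list of remaining variables is a parameter, so that an induction can strip the quantifiers
    of [sentence] one at a time. *)
Definition subsentence (s : seq 'I_n) : formula n :=
  foldr (fun v phi => FExists_ge (beta Psi v) v phi)
    (foldr (@FAnd n) FTrue [seq FAtom a.1 a.2 | a <- atoms Psi]) s.

Lemma sat_atomsP (a : 'I_n -> T) :
  sat E a (subsentence [::]) <->
  forall u v, (u, v) \in atoms Psi -> E (a u) (a v).
Proof.
rewrite /subsentence /=; elim: (atoms Psi) => [|[x y] s IHs] //=.
split=> [[Exy /IHs sE] u v|sE].
  by rewrite inE => /predU1P[[-> ->] //|]; apply: sE.
split; first by apply: sE; rewrite mem_head.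
by apply/IHs => u v uv; apply: sE; rewrite inE uv orbT.
Qed.

(** Needed because a quantifier yields at least [j] witnesses, whereas a legal offer has a
    prescribed size. *)
Lemma fset_card_exact (S : {fset T}) j : (j <= #|` S|)%N ->
  exists2 S' : {fset T}, #|` S'| = j & {subset S' <= S}.
Proof.
move=> jS; exists [fset x in take j S]%fset.
  rewrite card_fseq undup_id ?take_uniq ?fset_uniq //.
  by rewrite size_take_min (minn_idPl jS).
by move=> x; rewrite inE => /mem_take.
Qed.

(** Prover offers witnesses of the current quantifier, which keeps the rest of the sentence true
    under the values played so far. Symmetry of [E] enters because [edge] forgets the orientation of
    atoms. *)
Lemma models_prover_wins (t0 t1 : T) : symmetric E -> t0 != t1 ->
  models E (sentence Psi) -> prover_wins Psi E.
Proof.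
move=> Esym t01 mod.
(* Variables not yet played have the default value [t0], which their quantifiers overwrite. *)
pose asg (h : seq T) (u : 'I_n) := nth t0 h u.
pose good v h (S : {fset T}) := forall t, t \in S ->
  sat E (upd (asg h) v t) (subsentence (drop v.+1 (enum 'I_n))).
have offer v h : exists S : {fset T}, #|` S| = beta Psi v /\
    (sat E (asg h) (subsentence (drop v (enum 'I_n))) -> good v h S).
  have [sath|nsat] :=
      pselect (sat E (asg h) (subsentence (drop v (enum 'I_n)))).
    have := sath; rewrite drop_ord_enum /=.
    move=> [S0 /fset_card_exact[S cS sub] S0P].
    by exists S; split=> // _ t /sub/S0P.
  (* A legal strategy must also answer histories that violate the invariant; there a subset of [t0],
     [t1] of the right size serves. *)
  have [S0 cS0] : exists S0 : {fset T}, #|` S0| = 2.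
    by exists [fset t0; t1]%fset; rewrite cardfs2 t01.
  have [|S cS _] := @fset_card_exact S0 (beta Psi v); last by exists S.
  by rewrite cS0; case: (beta12 Psi v) => ->.
pose sigma v h := sval (cid (offer v h)).
exists sigma => [v h|f fP]; first by rewrite /sigma; case: cid => S [].
have sat_f k : (k <= n)%N ->
    sat E (asg [seq f u | u <- take k (enum 'I_n)])
      (subsentence (drop k (enum 'I_n))).
  elim: k => [|k IHk] lt_kn; first by rewrite take0 drop0; apply: mod.
  set v := Ordinal lt_kn; have := fP v; rewrite /sigma; case: cid => S /= [_].
  rewrite historyE => Sgood fvS.
  have := Sgood (IHk (ltnW lt_kn)) _ fvS.
  congr sat; apply: funext => u; rewrite -[k]/(val v) take_ord_enumS map_rcons.
  have size_v : size [seq f u | u <- take v (enum 'I_n)] = v.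
    by rewrite size_map size_takel // size_enum_ord ltnW.
  rewrite /upd /asg nth_rcons size_v -val_eqE.
  case: ltngtP => // vu.
  by rewrite nth_default // size_v ltnW.
have := sat_f n (leqnn n).
rewrite drop_oversize ?size_enum_ord // take_oversize ?size_enum_ord //.
have -> : asg [seq f u | u <- enum 'I_n] = f.
  apply: funext => u; rewrite /asg (nth_map u) ?size_enum_ord //.
  by rewrite nth_ord_enum.
by move/sat_atomsP => fE u v /orP[/fE //|/fE]; rewrite Esym.
Qed.

End Sentences.

(** * Looping walks: concatenation, parity and distance bounds *)

Section LoopingWalks.
Local Open Scope ring_scope.

Lemma P_infty_sym : symmetric P_infty.
Proof. by move=> i k; rewrite /P_infty distrC. Qed.

Lemma has_max_seq (s : seq int) : s != [::] ->
  exists2 m, m \in s & forall x, x \in s -> x <= m.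
Proof.
elim: s => // x [|y s] IHs _.
  by exists x => [|z]; rewrite inE // => /eqP->.
have [//|m ms mP] := IHs; have [le_mx|lt_xm] := leP m x.
  exists x; first by rewrite mem_head.
  by move=> z; rewrite inE => /predU1P[->//|/mP/le_trans]; apply.
exists m; first by rewrite inE ms orbT.
by move=> z; rewrite inE => /predU1P[->|/mP//]; apply: ltW.
Qed.

Variables (n : nat) (Psi : instance n).
Implicit Types (x y z u v : 'I_n) (p q : seq 'I_n).

(** The vertex [z] is internal to the concatenation at [z] without being an internal position of
    either part. *)
Lemma lambda_cat p z q :
  lambda Psi (p ++ z :: q) =
  lambda Psi p + lambda Psi q - 2 * ((beta Psi z)%:Z - 1).
Proof.
rewrite /lambda big_cat big_cons size_cat /=.
by move: (\sum_(w <- p) _) (\sum_(w <- q) _) => P Q; lia.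
Qed.

Lemma lambda_rev p : lambda Psi (rev p) = lambda Psi p.
Proof. by rewrite /lambda size_rev (perm_big p) // perm_rev. Qed.

Lemma looping_neq x p y : looping Psi x p y -> x != y.
Proof. by case. Qed.

Lemma looping_internal x p y w : looping Psi x p y -> w \in p ->
  (x < w)%N && (y < w)%N.
Proof. by case=> // {}x {}p z q {}y _ /allP xy _ _; apply: xy. Qed.

Lemma looping_sym x p y : looping Psi x p y -> looping Psi y (rev p) x.
Proof.
elim=> {x p y} [x y xy exy|x p z q y xy lt_xy _ IHp _ IHq].
  by apply: looping_edge; rewrite 1?eq_sym // /edge orbC.
rewrite rev_cat rev_cons cat_rcons; apply: looping_split => //.
  by rewrite eq_sym.
rewrite -cat_rcons -rev_cons -rev_cat all_rev.
by apply: sub_all lt_xy => w; rewrite andbC.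
Qed.

(** Internal vertices of either part come after [v], hence after both [u] and [w]. *)
Lemma looping_cat u p v q w : u != w -> (u < v)%N -> (w < v)%N ->
  looping Psi u p v -> looping Psi v q w -> looping Psi u (p ++ v :: q) w.
Proof.
move=> uw uv wv Lp Lq; apply: looping_split => //.
apply/allP => t; rewrite mem_cat inE => /or3P[/(looping_internal Lp)|/eqP->|
  /(looping_internal Lq)]; [|by rewrite uv|]; lia.
Qed.

(** [lambda] has the parity of the length of the walk. Any [f] that changes parity along edges is
    allowed, which covers homomorphisms and 2-colourings alike. *)
Lemma looping_parity (f : 'I_n -> int) x p y :
  (forall u v, edge Psi u v -> (2 %| f u + f v + 1)%Z) ->
  looping Psi x p y -> (2 %| f x + f y + lambda Psi p)%Z.
Proof.
move=> fE; elim=> {x p y} [x y _ /fE|x p z q y _ _ _ IHp _ IHq].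
  by rewrite /lambda big_nil.
rewrite lambda_cat; move: IHp IHq.
by move: (lambda Psi p) (lambda Psi q) => P Q; lia.
Qed.

Lemma homomorphism_parity (f : 'I_n -> int) x p y :
  homomorphism (edge Psi) P_infty f ->
  looping Psi x p y -> (2 %| f x + f y + lambda Psi p)%Z.
Proof.
by move=> fE; apply: looping_parity => u v /fE; rewrite /P_infty; lia.
Qed.

Lemma deltaP u v : is_delta Psi u v (delta Psi u v).
Proof. exact: svalP (cid (is_delta_exists Psi u v)). Qed.

Lemma winning_play_bound (sigma : strategy n int) f x p y :
  legal Psi sigma ->
  (forall g, play sigma g -> homomorphism (edge Psi) P_infty g) ->
  play sigma f -> looping Psi x p y -> `|f x - f y| <= lambda Psi p.
Proof.
move=> leg win fP Lp.
(* The induction ranges over all plays, since the case [beta Psi z = 2] compares two of them. *)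
elim: Lp f fP => {x p y}
    [x y _ exy|x p z q y _ lt_z Lp IHp Lq IHq] f fP.
  by have := win f fP _ _ exy; rewrite /P_infty /lambda big_nil; lia.
have /andP[xz yz] : (x < z)%N && (y < z)%N.
  by move/allP: lt_z; apply; rewrite mem_cat mem_head orbT.
rewrite lambda_cat; have := IHp f fP; have := IHq f fP.
have parf := homomorphism_parity (win f fP) Lp.
case: (beta12 Psi z) => bz; rewrite bz.
  by move: (lambda Psi p) (lambda Psi q) => P Q; lia.
(* [x] and [y] precede [z], so they keep their values in [g]. *)
have [g [gP gf gz]] := play_other_value leg fP bz.
have := IHp g gP; have := IHq g gP.
have parg := homomorphism_parity (win g gP) Lp.
move: parf parg gz; rewrite (gf x xz) (gf y yz).
by move: (lambda Psi p) (lambda Psi q) => P Q; lia.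
Qed.

(* The values must have the parity of a 2-colouring c, so that atoms end up
   at distance exactly 1. *)
Definition partial_solution (c : 'I_n -> bool) (k : nat) (a : 'I_n -> int) :=
  (forall x p y, (x < k)%N -> (y < k)%N -> looping Psi x p y ->
     `|a x - a y| <= lambda Psi p) /\
  (forall x, (x < k)%N -> (2 %| a x + (c x)%:Z)%Z).

(** The offer is the largest lower bound [t0] on the next value, together with [t0 + 2] if
    [beta Psi v = 2]; the shift by 2 preserves parity. *)
Lemma partial_solution_extend c v a :
  (forall u w, edge Psi u w -> c u != c w) ->
  (forall x p y, ~ bad_walk Psi x p y) ->
  partial_solution c v a ->
  exists2 S : {fset int}, (beta Psi v <= #|` S|)%N &
    forall t, t \in S -> partial_solution c v.+1 (upd a v t).
Proof.
move=> cE nobad [abd apar].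
(* Together with [apar] this gives the lower bounds the parity prescribed at [v]. *)
have cpar x p y : looping Psi x p y ->
    (2 %| (c x)%:Z + (c y)%:Z + lambda Psi p)%Z.
  apply: (looping_parity (f := fun u => (c u)%:Z)) => u w /cE.
  by case: (c u) (c w) => [] [].
(* [fine] is a dummy at [+oo]; [L] discards such [u]. *)
pose lo u : int := a u - fine (delta Psi u v).
pose L := [seq lo u | u : 'I_n <- enum 'I_n &
  (u < v)%N && (delta Psi u v < +oo)%E].
have minimal_walk u : (delta Psi u v < +oo)%E ->
    exists2 p, looping Psi u p v & lambda Psi p = fine (delta Psi u v).
  have := deltaP u v; case: (delta Psi u v) => // m [[p [Lp|Lp] lp] _] _.
    by exists p.
  by exists (rev p); [exact: looping_sym | rewrite lambda_rev].
have delta_le u p : looping Psi u p v ->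
    (delta Psi u v < +oo)%E /\ fine (delta Psi u v) <= lambda Psi p.
  move=> Lp; have := deltaP u v; case: (delta Psi u v) => //= [m [_ mP]|mP].
    by rewrite ltry; split=> //; apply: mP; left.
  by case: (mP p); left.
have [t0 [t0par t0lo t0hi]] : exists t0 : int,
  [/\ (2 %| t0 + (c v)%:Z)%Z,
      forall u p, (u < v)%N -> looping Psi u p v -> a u - lambda Psi p <= t0 &
      forall u p, (u < v)%N -> looping Psi u p v ->
        t0 + 2 * ((beta Psi v)%:Z - 1) <= a u + lambda Psi p].
  have memL u p : (u < v)%N -> looping Psi u p v -> lo u \in L.
    move=> uv Lp; apply: map_f; rewrite mem_filter uv mem_enum andbT /=.
    by have [] := delta_le u p Lp.
  have [L0|/has_max_seq[m /mapP[w]]] := eqVneq L [::].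
    (* No earlier vertex is joined to [v] by a looping walk, so only parity matters. *)
    exists (c v)%:Z; split; first by case: (c v).
      by move=> u p uv /(memL u p uv); rewrite L0.
    by move=> u p uv /(memL u p uv); rewrite L0.
  rewrite mem_filter => /andP[/andP[wv dw] _] -> mmax.
  have [q Lq lq] := minimal_walk w dw.
  exists (lo w); rewrite /lo -lq; split=> [|u p uv Lp|u p uv Lp].
  - have := cpar _ _ _ Lq; have := apar w wv.
    by case: (c w) (c v) => [] []; lia.
  - have := mmax _ (memL u p uv Lp); rewrite /lo -lq.
    by have [_] := delta_le u p Lp; lia.
  (* If [w = u], the concatenation at [v] is closed, hence not looping; the absence of bad walks
     gives [lambda Psi q >= beta Psi v - 1] instead. *)
  have [uw|uw] := eqVneq w u.
    subst u; have [_] := delta_le w p Lp; rewrite -lq.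
    have: ~ lambda Psi q <= (beta Psi v)%:Z - 2.
      by move=> bad; apply: (nobad w q v).
    by lia.
  have := abd _ _ _ wv uv (looping_cat uw wv uv Lq (looping_sym Lp)).
  by rewrite lambda_cat lambda_rev; lia.
exists [fset t0; (t0 + 2 * ((beta Psi v)%:Z - 1))%R]%fset.
  by rewrite cardfs2; case: (beta12 Psi v) => ->; case: eqP => //; lia.
move=> t tS.
have [tpar tge tle] : [/\ (2 %| t + (c v)%:Z)%Z, t0 <= t &
    t <= t0 + 2 * ((beta Psi v)%:Z - 1)].
  by move: tS; rewrite !inE => /orP[]/eqP->; split=> //;
    case: (beta12 Psi v) => ->; lia.
have bd u p : (u < v)%N -> looping Psi u p v -> `|a u - t| <= lambda Psi p.
  by move=> uv Lp; have := t0lo u p uv Lp; have := t0hi u p uv Lp; lia.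
have lt_neq u : (u < v)%N -> u == v = false.
  by move=> uv; rewrite -val_eqE ltn_eqF.
rewrite /partial_solution /upd; split=> [x p y|x]; last first.
  rewrite ltnS leq_eqVlt => /predU1P[/val_inj->|xv]; first by rewrite eqxx.
  by rewrite lt_neq ?apar.
rewrite ltnS leq_eqVlt => /predU1P[/val_inj->|xv].
  rewrite eqxx ltnS leq_eqVlt => /predU1P[/val_inj->|yv].
    by move/looping_neq; rewrite eqxx.
  by rewrite lt_neq // distrC -lambda_rev => /looping_sym; apply: bd.
rewrite (lt_neq x) // ltnS leq_eqVlt => /predU1P[/val_inj->|yv].
  by rewrite eqxx; apply: bd.
by rewrite lt_neq //; apply: abd.
Qed.

Lemma no_bad_walk_models : bipartite (edge Psi) ->
  (forall x p y, ~ bad_walk Psi x p y) -> models P_infty (sentence Psi).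
Proof.
move=> [c cE] nobad a; rewrite -[sentence Psi]/(subsentence Psi (enum 'I_n)).
rewrite -(drop0 (enum 'I_n)).
have: partial_solution c 0 a by split.
have: (0 <= n)%N by [].
(* Induction on the number [n - k] of quantifiers left. *)
move: 0%N a => k a; have [m] := ubnP (n - k)%N.
elim: m k a => // m IHm k a lt_m; rewrite leq_eqVlt => /predU1P[->|lt_kn] aP.
  rewrite drop_oversize ?size_enum_ord //; apply/sat_atomsP => u v uv.
  have euv : edge Psi u v by rewrite /edge uv.
  have neq_c := cE _ _ euv; have [abd apar] := aP.
  have uv' : u != v by apply: contraNneq neq_c => ->.
  (* An edge is a looping walk with [lambda] equal to 1, and opposite colours exclude equal
     values. *)
  have := abd u [::] v (ltn_ord u) (ltn_ord v) (looping_edge uv' euv).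
  have := apar u (ltn_ord u); have := apar v (ltn_ord v).
  rewrite /P_infty /lambda big_nil /=.
  by case: (c u) (c v) neq_c => [] [] //; lia.
pose v := Ordinal lt_kn.
have [S cS SP] := partial_solution_extend (v := v) cE nobad aP.
rewrite -[k]/(val v) drop_ord_enum; exists S => // t tS.
by apply: IHm => //=; [lia | apply: SP].
Qed.

End LoopingWalks.

Theorem theorem19 (n : nat) (Psi : instance n)
    (hG : bipartite (edge Psi)) :
  [<-> (* I *) models P_infty (sentence Psi);
       (* II *) prover_wins Psi P_infty;
       (* III *) prover_can_ensure Psi (fun f : 'I_n -> int =>
         forall u v : 'I_n, (delta Psi u v < +oo)%E ->
           ((`|f u - f v|%R)%:E <= delta Psi u v)%E /\
           (2 %| (f u + f v + fine (delta Psi u v))%R)%Z);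
       (* IV *) ~ exists u v : 'I_n,
         (u < v)%N /\ (delta Psi u v <= ((beta Psi v)%:Z - 2)%R%:E)%E;
       (* V *) ~ exists (x : 'I_n) (p : seq 'I_n) (y : 'I_n),
         bad_walk Psi x p y].
Proof.
tfae.
- exact: (models_prover_wins (t0 := 0%R) (t1 := 1%R) P_infty_sym).
- move=> [sigma leg win]; exists sigma => // f fP u v.
  have := deltaP Psi u v; case: (delta Psi u v) => // m [[p [Lp|Lp] <-] _] _ /=.
    split; first by rewrite lee_fin; apply: winning_play_bound Lp.
    exact: homomorphism_parity (win f fP) Lp.
  split; first by rewrite lee_fin distrC; apply: winning_play_bound Lp.
  by rewrite [(f u + _)%R]addrC; apply: homomorphism_parity (win f fP) Lp.
- move=> [sigma leg W] [u [v [uv dle]]].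
  have dfin : (delta Psi u v < +oo)%E by apply: le_lt_trans dle _; rewrite ltry.
  have bound f : play sigma f -> (`|f u - f v| <= (beta Psi v)%:Z - 2)%R.
    by move=> /W/(_ u v dfin)[/le_trans/(_ dle)]; rewrite lee_fin.
  have [f fP] := play_exists leg; have := bound f fP.
  (* For [beta Psi v = 1] the bound is -1, which is absurd. For [beta Psi v = 2] it is 0, so [v]
     gets the value of [u] in every play, yet Adversary can choose another one. *)
  case: (beta12 Psi v) => bv; first by rewrite bv; lia.
  have [g [gP gf gv]] := play_other_value leg fP bv.
  by have := bound g gP; rewrite bv (gf u uv); move: gv; lia.
- move=> nodelta [x [p [y [Lp xy lp]]]]; apply: nodelta; exists x, y.
  split=> //.
  have := deltaP Psi x y; case: (delta Psi x y) => //= [m [_ mP]|nwalk].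
    by rewrite lee_fin; apply: le_trans lp; apply: mP; left.
  by case: (nwalk p); left.
- move=> nobad; apply: no_bad_walk_models => // x p y bad.
  by apply: nobad; exists x, p, y.
Qed.
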